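(* Let $t\ge s\ge k$, where $k\in\{2,3\}$. Let $G$ be a $k$-connected bipartite graph whose partition classes have $s$ and $t$ vertices, and let $H\subset G$ be a minimum spanning $k$-connected subgraph. If $e(H)=kt$, then \[ mc_k(G)=e(G)-kt+1. \] Moreover, if $s=t$, then the same conclusion holds for every $k\in\{2,3,4,5\}$ (with $t\ge k$).
   Context: All graphs are finite, simple and undirected. A graph is $k$-connected if it has at least $k+1$ vertices and remains connected after deleting any at most $k-1$ vertices. Paths are called disjoint if they are internally vertex-disjoint. An edge-coloured path is monochromatic if all its edges have the same colour. For a $k$-connected graph $G$, an edge-colouring is monochromatic $k$-connected if any two vertices are connected by $k$ disjoint monochromatic paths; $mc_k(G)$ is the maximum number of colours in a monochromatic $k$-connected colouring of $G$. A minimum spanning $k$-connected subgraph of $G$ is a $k$-connected subgraph $H$ with $V(H)=V(G)$ and $e(H)$ minimum among such subgraphs. *)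

(* Defs.v *)
From mathcomp Require Import all_boot.
Set Implicit Arguments. Unset Strict Implicit. Unset Printing Implicit Defensive.

Section Graphs.
Variable T : finType.

Definition simple_graph (e : rel T) : Prop := symmetric e /\ irreflexive e.

Definition edges (e : rel T) : {set {set T}} :=
  [set [set x; y] | x in T, y in T & e x y].
Definition nedges (e : rel T) : nat := #|edges e|.

Definition restrict (e : rel T) (S : {set T}) : rel T :=
  [rel x y | [&& e x y, x \in S & y \in S]].

Definition kconnected (k : nat) (e : rel T) : Prop :=
  k.+1 <= #|T| /\
  forall D : {set T}, #|D| < k ->
    forall x y, x \notin D -> y \notin D -> connect (restrict e (~: D)) x y.

Definition spanning_subgraph (h e : rel T) : Prop :=
  symmetric h /\ subrel h e.

Definition min_spanning_kconn (k : nat) (e h : rel T) : Prop :=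
  spanning_subgraph h e /\ kconnected k h /\
  forall h', spanning_subgraph h' e -> kconnected k h' -> nedges h <= nedges h'.

Definition is_path (e : rel T) (u v : T) (p : seq T) : bool :=
  [&& path e u p, last u p == v & uniq (u :: p)].

(* interior vertices of the path u :: p ending in v *)
Definition interior (v : T) (p : seq T) : seq T := [seq x <- p | x != v].

Definition monochromatic (c : {set T} -> nat) (u : T) (p : seq T) : Prop :=
  exists i : nat, all (fun xy => c [set xy.1; xy.2] == i) (zip (u :: p) p).

Definition mono_kconn_colouring (k : nat) (e : rel T) (c : {set T} -> nat)
  : Prop :=
  forall u v : T, u != v ->
    exists ps : seq (seq T),
      [/\ size ps = k, uniq ps,
          (forall p, p \in ps -> is_path e u v p /\ monochromatic c u p) &
          (forall i j, i < j < k ->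
             ~~ has (fun x => x \in interior v (nth [::] ps j))
                    (interior v (nth [::] ps i)))].

Definition ncolours (e : rel T) (c : {set T} -> nat) : nat :=
  size (undup [seq c E | E <- enum (edges e)]).

Definition mc_eq (k : nat) (e : rel T) (n : nat) : Prop :=
  (exists c, mono_kconn_colouring k e c /\ ncolours e c = n) /\
  (forall c, mono_kconn_colouring k e c -> ncolours e c <= n).

Definition bipartite_classes (e : rel T) (s t : nat) : Prop :=
  exists A : {set T}, [/\ #|A| = s, #|~: A| = t &
    forall x y, e x y -> (x \in A) != (y \in A)].

End Graphs.

(* Main.v *)
Require Import Defs.
From mathcomp Require Import all_boot zify.
Set Implicit Arguments. Unset Strict Implicit. Unset Printing Implicit Defensive.

(** Lower bound: give all edges of [h] one colour and all other edges distinct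
    colours; Menger's theorem in [h] provides the [k] disjoint paths.

    Upper bound: splitting the colour classes into connected components
    ("blocks") only increases the number of colours, so it suffices to show
    [sum_i (n_i - 1) >= k t - 1], where block [i] has [n_i] edges and meets the
    two partition classes in [a_i] and [b_i] vertices; note
    [n_i >= a_i + b_i - 1].  Two vertices [v], [w] of one class are not adjacent,
    so [v] has at least [k] edges in blocks containing [w].  Summing this over
    all pairs of the class of size [t] gives [sum_i n_i (b_i - 1) >= k t (t - 1)].
    A block with [b_i < t] satisfies [(t - 1) (n_i - 1) >= n_i (b_i - 1)], and a
    spanning block ([b_i = t]) misses this by exactly [t - 1]; hence
    [sum_i (n_i - 1) >= k t - p] with [p] the number of spanning blocks.
    This settles [p <= 1].  If [p = 2], equality would force all edges at [v] and
    [w] in their common blocks to be used by the paths between them, so that no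
    vertex of the other class lies in both spanning blocks, while all
    non-spanning blocks meet the other class only once: then the other class is
    not connected by blocks.  If [p >= k], use
    [sum_i (n_i - 1) >= sum_i (b_i - 1) + sum_i (a_i - 1) >= k (t - 1) + s - 1].
    This covers [k <= 3]; if [s = t] and [k <= 5], the remaining case has at least
    three spanning blocks for either class, and
    [sum_i (n_i - 1) >= 6 (t - 1) >= k t - 1]. *)

(** * Menger's theorem *)

Section Menger.
Variable T : finType.
Implicit Types (g : rel T) (A B S W : {set T}).

(** Walks of length zero count, so [S] has to contain [A :&: B]. *)
Definition separates g A B S : Prop :=
  forall a b, a \in A :\: S -> b \in B :\: S -> ~ connect (restrict g (~: S)) a b.

Definition linkage k g A B (P : 'I_k -> T * seq T) : Prop :=
  (forall i, [/\ (P i).1 \in A, path g (P i).1 (P i).2,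
     last (P i).1 (P i).2 \in B & uniq ((P i).1 :: (P i).2)]) /\
  (forall i j z, z \in (P i).1 :: (P i).2 -> z \in (P j).1 :: (P j).2 -> i = j).

(** Relations are directed here: only the arc from [x] to [y] is removed. *)
Definition del_edge g (x y : T) : rel T :=
  [rel u v | g u v && ~~ ((u == x) && (v == y))].

Lemma path_restrict_connect g S x p :
    path g x p -> {subset x :: p <= ~: S} ->
  connect (restrict g (~: S)) x (last x p).
Proof.
elim: p x => [|y p IHp] x /=; first by rewrite connect0.
case/andP=> gxy pth sub; apply: connect_trans (IHp y pth _).
  by apply: connect1; rewrite /restrict /= gxy !sub // !inE eqxx ?orbT.
by move=> z zp; apply: sub; rewrite inE zp orbT.
Qed.

Lemma separates_first g A B S W x y :
    separates g A B (x |: S) -> separates (del_edge g x y) A (x |: S) W ->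
  separates g A B W.
Proof.
move=> sepP sepW a b; rewrite !inE => /andP[aW aA] /andP[bW bB].
set g' := del_edge g x y in sepW *.
case/connectP => p pth lastb.
suff [[z zP cz]|[cab aP bP]] :
    (exists2 z, z \in (x |: S) :\: W & connect (restrict g' (~: W)) a z) \/
    [/\ connect (restrict g (~: (x |: S))) a b, a \notin x |: S &
        b \notin x |: S].
- by apply: (sepW a z) => //; rewrite inE aW.
- by apply: (sepP a b) => //; rewrite inE ?aP ?bP.
elim: p a aW {aA} pth lastb => [|c p IHp] a aW /=.
  move=> _ ->; case: (boolP (a \in x |: S)) => aP; [left|right].
    by exists a; rewrite // inE aW.
  by split.
case/andP=> /and3P[gac _ cW] pth lastb; rewrite inE in cW.
have [aP|aP] := boolP (a \in x |: S).
  by left; exists a; rewrite // inE aW.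
have ax : a != x by apply: contra aP => /eqP->; rewrite !inE eqxx.
have [[z zP cz]|[cb cP bP]] := IHp c cW pth lastb; [left|right].
  exists z => //; apply: connect_trans cz; apply: connect1.
  by rewrite /restrict /g' /del_edge /= gac !inE aW cW (negbTE ax).
split=> //; apply: connect_trans cb; apply: connect1.
by rewrite /restrict /= gac !in_setC aP cP.
Qed.

(** Mirror image: after its last vertex in [y |: S] a walk never enters [y], so its remainder
    survives the deletion. *)
Lemma separates_last g A B S W x y :
    separates g A B (y |: S) -> separates (del_edge g x y) (y |: S) B W ->
  separates g A B W.
Proof.
move=> sepP sepW a b; rewrite !inE => /andP[aW aA] /andP[bW bB].
set g' := del_edge g x y in sepW *.
case/connectP => p pth lastb.
(* The tail of the walk is treated first, so the case without a vertex of [y |: S] must also record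
   a walk in [g']. *)
suff [[z zP cz]|[_ cab aP bP]] :
    (exists2 z, z \in (y |: S) :\: W & connect (restrict g' (~: W)) z b) \/
    [/\ connect (restrict g' (~: W)) a b,
        connect (restrict g (~: (y |: S))) a b, a \notin y |: S &
        b \notin y |: S].
- by apply: (sepW z b) => //; rewrite inE bW.
- by apply: (sepP a b) => //; rewrite inE ?aP ?bP.
elim: p a aW {aA} pth lastb => [|c p IHp] a aW /=.
  move=> _ ->; case: (boolP (a \in y |: S)) => aP; [left|right].
    by exists a; rewrite // inE aW.
  by split.
case/andP=> /and3P[gac _ cW] pth lastb; rewrite inE in cW.
have [|[cb cgb cP bP]] := IHp c cW pth lastb; first by left.
have cy : c != y by apply: contra cP => /eqP->; rewrite !inE eqxx.
have cab : connect (restrict g' (~: W)) a b.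
  apply: connect_trans cb; apply: connect1.
  by rewrite /restrict /g' /del_edge /= gac !inE aW cW (negbTE cy) andbF.
have [aP|aP] := boolP (a \in y |: S); [left|right].
  by exists a; rewrite // inE aW.
split=> //; apply: connect_trans cgb; apply: connect1.
by rewrite /restrict /= gac !in_setC aP cP.
Qed.

(** A walk through the deleted arc visits both its ends, so removing either one destroys it. *)
Lemma separates_del_edge g A B S x y z : z \in [:: x; y] ->
  separates (del_edge g x y) A B S -> separates g A B (z |: S).
Proof.
move=> zxy sepS a b; rewrite !inE !negb_or => /andP[/andP[_ aS] aA].
case/andP=> /andP[_ bS] bB cab; apply: (sepS a b); rewrite ?inE ?aS ?bS //.
apply: connect_sub cab => u v; rewrite /restrict /= !inE !negb_or.
case/and3P=> guv /andP[uz uS] /andP[vz vS]; apply: connect1.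
rewrite /restrict /del_edge /= guv !inE uS vS !andbT /= negb_and.
by move: zxy uz vz; rewrite !inE => /orP[]/eqP-> uz vz;
  rewrite ?uz ?vz ?orbT.
Qed.

(** Disjoint paths have [k] distinct ends in [B], which has no room for further vertices. *)
Lemma linkage_end_onto k g A B (P : 'I_k -> T * seq T) : linkage g A B P ->
  #|B| <= k -> forall z, z \in B -> exists i, last (P i).1 (P i).2 = z.
Proof.
move=> [Pp Pd] cB z zB; pose f i := last (P i).1 (P i).2.
have injf : injective f.
  by move=> i j ij; apply: (Pd i j (f i)); [|rewrite ij]; apply: mem_last.
have fE : f @: setT = B.
  apply/eqP; rewrite eqEcard card_imset // cardsT card_ord cB andbT.
  by apply/subsetP=> _ /imsetP[i _ ->]; case: (Pp i).
by move: zB; rewrite -fE => /imsetP[i _ ->]; exists i.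
Qed.

Lemma linkage_start_onto k g A B (P : 'I_k -> T * seq T) : linkage g A B P ->
  #|A| <= k -> forall z, z \in A -> exists i, (P i).1 = z.
Proof.
move=> [Pp Pd] cA z zA; pose f i := (P i).1.
have injf : injective f.
  by move=> i j ij; apply: (Pd i j (f i)); [|rewrite ij]; apply: mem_head.
have fE : f @: setT = A.
  apply/eqP; rewrite eqEcard card_imset // cardsT card_ord cA andbT.
  by apply/subsetP=> _ /imsetP[i _ ->]; case: (Pp i).
by move: zA; rewrite -fE => /imsetP[i _ ->]; exists i.
Qed.


(** Without arcs [A :&: B] is itself a separator, and its vertices are trivial paths. *)
Lemma linkage0 k g A B : (forall x y, ~~ g x y) ->
    (forall S, separates g A B S -> k <= #|S|) ->
  exists P : 'I_k -> T * seq T, linkage g A B P.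
Proof.
move=> noE sepk.
have kAB : k <= #|A :&: B|.
  apply: sepk => a b; rewrite !inE => /andP[aAB aA] /andP[bAB bB].
  case/connectP=> -[|c p] /=; last by rewrite /restrict /= (negbTE (noE _ _)).
  by move=> _ ba; move: aAB; rewrite aA -ba bB.
pose f i := enum_val (widen_ord kAB i).
exists (fun i => (f i, [::])); split=> [i|i j z] /=.
  by have := enum_valP (widen_ord kAB i); rewrite inE => /andP[].
rewrite !inE => /eqP-> /eqP/enum_val_inj/(congr1 val) /= ij.
exact: val_inj.
Qed.

(** A path of [p] ending in [S] is continued by the path of [q] starting there; the one ending in
    [x] is continued through the arc to [y]. Separation by [S] excludes all other intersections. *)
Lemma linkage_glue k g A B S x y (p q : 'I_k -> T * seq T) : g x y ->
    separates (del_edge g x y) A B S -> x \notin S -> y \notin S -> #|S| < k ->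
    linkage (del_edge g x y) A (x |: S) p ->
    linkage (del_edge g x y) (y |: S) B q ->
  exists P : 'I_k -> T * seq T, linkage g A B P.
Proof.
set g' := del_edge g x y => gxy sepS xS yS Sk linkp linkq.
have ponto := linkage_end_onto linkp; have qonto := linkage_start_onto linkq.
rewrite cardsU1 xS in ponto; rewrite cardsU1 yS in qonto.
have {}ponto := ponto Sk; have {}qonto := qonto Sk.
case: linkp => pP pD; case: linkq => qP qD.
have g'g u s : path g' u s -> path g u s by apply: sub_path => ? ? /andP[].
have endp i z : z \in (p i).1 :: (p i).2 -> z \in x |: S ->
    z = last (p i).1 (p i).2.
  move=> zp /ponto[i' zi']; rewrite -zi'.
  by rewrite (pD i i' z) //; rewrite -zi' mem_last.
have startq j z : z \in (q j).1 :: (q j).2 -> z \in y |: S -> z = (q j).1.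
  move=> zq /qonto[j' zj']; rewrite -zj'.
  by rewrite (qD j j' z) //; rewrite -zj' mem_head.
(* If [z] were outside [S], following [p i] up to [z] and then [q j] would lead from [A] to [B]
   around [S]. *)
have meet i j z : z \in (p i).1 :: (p i).2 -> z \in (q j).1 :: (q j).2 -> z \in S.
  move=> zp zq; apply: contraT => zS; exfalso.
  have [pA pth _ pU] := pP i; have [_ qth qB qU] := qP j.
  move: (endp i) (startq j) zp zq pA pth pU qth qB qU.
  case: (p i) (q j) => [a s] [b r] /= enda startb zp.
  case/splitPl: zp enda => s1 s2 lasts1 enda zq.
  case/splitPl: zq startb => r1 r2 lastr1 startb aA.
  rewrite !cat_path lasts1 lastr1 last_cat lastr1.
  move=> /andP[pth1 _] pU /andP[_ qth2] qB qU.
  (* Only the end of [p i] can lie in [S]; if the initial part contains that end, it is [z], which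
     is outside [S]. *)
  have sub1 : {subset a :: s1 <= ~: S}.
    move=> w ws; rewrite inE; apply/negP => wS.
    have wE : w = last a (s1 ++ s2).
      apply: enda; last by rewrite !inE wS orbT.
      by move: ws; rewrite !inE mem_cat => /orP[->|->] //; rewrite orbT.
    case: s2 pU wE {enda} => [|c s2] pU wE.
      by move: wS; rewrite wE cats0 lasts1 (negbTE zS).
    have wl : w \in c :: s2 by rewrite wE last_cat /= mem_last.
    move: pU; rewrite -[_ && _]/(uniq ((a :: s1) ++ c :: s2)) cat_uniq => /and3P[_ /hasPn/(_ _ wl)] /=.
    by rewrite ws.
  have sub2 : {subset z :: r2 <= ~: S}.
    move=> w ws; rewrite inE; apply/negP => wS.
    have wE : w = b.
      apply: startb; last by rewrite !inE wS orbT.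
      move: ws; rewrite inE => /orP[/eqP->|wr].
        by rewrite -lastr1 -cat_cons mem_cat mem_last.
      by rewrite inE mem_cat wr !orbT.
    case: r1 lastr1 qU {startb} => [|c r1] /= lastr1 qU.
      by move: zS; rewrite -lastr1 -wE wS.
    case/andP: qU => /negP[]; rewrite -wE -cat_cons mem_cat.
    move: ws; rewrite inE => /orP[/eqP->|->]; last by rewrite orbT.
    by rewrite -lastr1 mem_last.
  apply: (sepS a (last z r2)).
  - by rewrite inE aA andbT -in_setC sub1 // mem_head.
  - by rewrite inE qB andbT -in_setC sub2 // mem_last.
  apply: connect_trans (path_restrict_connect qth2 sub2).
  by rewrite -lasts1; apply: path_restrict_connect.
(* [tau] sends the start of a path of [q] to the end of the path of [p] that must precede it. *)
pose tau z := if z == y then x else z.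
have tauS z : z \in y |: S -> tau z \in x |: S.
  by rewrite /tau !inE; case: eqP => _ /=; rewrite ?eqxx // => ->; rewrite orbT.
have [sg sgP] : exists sg, forall j,
    last (p (sg j)).1 (p (sg j)).2 = tau (q j).1.
  apply: (@fin_all_exists _ _ (fun j i => last (p i).1 (p i).2 = tau (q j).1)).
  by move=> j; apply/ponto/tauS; case: (qP j).
have cross j j' z : z \in (p (sg j)).1 :: (p (sg j)).2 ->
    z \in (q j').1 :: (q j').2 -> [/\ z = (q j').1, z = (q j).1 & (q j).1 != y].
  move=> zp zq; have zS := meet _ _ _ zp zq.
  have zE : z = tau (q j).1 by rewrite -sgP; apply: endp; rewrite // !inE zS orbT.
  have zq' : z = (q j').1 by apply: startq; rewrite // !inE zS orbT.
  move: zE; rewrite /tau; case: eqP => [_ zx|] //.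
  by move: zS; rewrite zx (negbTE xS).
(* A junction in [S] is already the last vertex of the first half and is dropped; [y] is not and has
   to be kept. *)
pose tl j := if (q j).1 == y then y :: (q j).2 else (q j).2.
have tlq j : {subset tl j <= (q j).1 :: (q j).2}.
  by move=> z; rewrite /tl; case: eqP => [->|_] // zq; rewrite inE zq orbT.
have memR j z : z \in (p (sg j)).1 :: (p (sg j)).2 ++ tl j ->
    z \in (p (sg j)).1 :: (p (sg j)).2 \/ z \in (q j).1 :: (q j).2.
  by rewrite -cat_cons mem_cat => /orP[->|/tlq->]; [left|right].
exists (fun j => ((p (sg j)).1, (p (sg j)).2 ++ tl j)); split=> [j|j j' z] /=.
  have [pA pth _ pU] := pP (sg j); have [_ qth qB qU] := qP j.
  split=> //.
  - rewrite cat_path g'g //= sgP /tau /tl; case: eqP => [qy|_]; last exact: g'g.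
    by rewrite /= gxy g'g // -qy.
  - by rewrite last_cat sgP /tau /tl; case: eqP => [<-|].
  rewrite -cons_uniq -cat_cons cat_uniq pU /=; apply/andP; split; last first.
    by rewrite /tl; case: eqP => [<-|_] //; case/andP: qU.
  apply/hasPn => z ztl; apply/negP => zp.
  have [zq _ /negbTE qy] := cross _ _ _ zp (tlq _ _ ztl).
  by move: ztl qU; rewrite /tl qy zq /= => ->.
move=> /memR[zp|zq] /memR[zp'|zq'].
- have ss : sg j = sg j' by apply: pD zp zp'.
  have : tau (q j).1 = tau (q j').1 by rewrite -!sgP ss.
  have [[qS _ _ _] [qS' _ _ _]] := (qP j, qP j').
  have jj' : (q j).1 = (q j').1 -> j = j'.
    by move=> E; apply: (qD j j' (q j).1); rewrite ?mem_head // E mem_head.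
  move: qS qS' jj'; rewrite /tau !inE.
  case: eqP => [-> _|_ /= qS]; case: eqP => [-> _|_ /= qS'] //.
  - by move=> jj' _; apply: jj'.
  - by move=> _ E; move: qS'; rewrite -E (negbTE xS).
  - by move=> _ E; move: qS; rewrite E (negbTE xS).
- have [zj' zj _] := cross _ _ _ zp zq'.
  by apply: (qD j j' z) => //; rewrite zj mem_head.
- have [zj' zj _] := cross _ _ _ zp' zq.
  by apply: (qD j j' z) => //; rewrite zj mem_head.
- exact: qD zq zq'.
Qed.

(* Goering's proof, by induction on the number of edges. *)
Theorem menger k g A B : (forall S, separates g A B S -> k <= #|S|) ->
  exists P : 'I_k -> T * seq T, linkage g A B P.
Proof.
have [n] := ubnP #|[set z : T * T | g z.1 z.2]|.
elim: n g A B => // n IHn g A B; rewrite ltnS => gn sepk.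
have [/existsP[[x y] /= gxy]|noE] := boolP [exists z : T * T, g z.1 z.2]; last first.
  apply: linkage0 sepk => x y; apply: contra noE => gxy.
  by apply/existsP; exists (x, y).
have g'n : #|[set z : T * T | del_edge g x y z.1 z.2]| < n.
  apply: leq_trans gn; apply/proper_card/properP; split.
    by apply/subsetP => z; rewrite !inE => /andP[].
  by exists (x, y); rewrite !inE // /del_edge /= gxy !eqxx.
have sub : subrel (del_edge g x y) g by move=> u v /andP[].
have [/existsP[S /andP[Sk sepS]]|noS] := boolP [exists S : {set T},
    (#|S| < k) && [forall a in A :\: S, forall b in B :\: S,
      ~~ connect (restrict (del_edge g x y) (~: S)) a b]]; last first.
  have [|P [PP PD]] := IHn _ A B g'n.
    move=> S sepS; rewrite leqNgt; apply: contra noS => Sk.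
    apply/existsP; exists S; rewrite Sk; apply/forall_inP => a aA.
    by apply/forall_inP => b bB; apply/negP/sepS.
  exists P; split => // i; have [PA pth PB PU] := PP i; split=> //.
  by apply: sub_path pth.
have {}sepS : separates (del_edge g x y) A B S.
  move=> a b aA bB; apply/negP.
  by have /forall_inP/(_ a aA)/forall_inP/(_ b bB) := sepS.
have sepx : separates g A B (x |: S).
  by apply: separates_del_edge sepS; rewrite mem_head.
have sepy : separates g A B (y |: S).
  by apply: separates_del_edge sepS; rewrite !inE eqxx orbT.
(* [S] has fewer than [k] elements, while [x |: S] separates in [g] and so has at least [k]. *)
have xS : x \notin S.
  by have := sepk _ sepx; rewrite cardsU1; case: (x \in S) => //; lia.
have yS : y \notin S.
  by have := sepk _ sepy; rewrite cardsU1; case: (y \in S) => //; lia.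
have [|p linkp] := IHn _ A (x |: S) g'n.
  by move=> W sepW; apply/sepk/(separates_first sepx sepW).
have [|q linkq] := IHn _ (y |: S) B g'n.
  by move=> W sepW; apply/sepk/(separates_last sepy sepW).
exact: linkage_glue gxy sepS xS yS Sk linkp linkq.
Qed.

End Menger.

(** * Internally disjoint paths between two vertices of a [k]-connected graph *)

Section DisjointPaths.
Variables (T : finType) (h : rel T) (k : nat).
Hypotheses (symh : symmetric h) (irrh : irreflexive h).

Lemma restrict_sym (S : {set T}) : symmetric (restrict h S).
Proof.
by move=> x y; rewrite /restrict /= symh [(x \in S) && _]andbC.
Qed.

(** Stop a walk at its first arrival in [v]; [b] is the vertex just before. *)
Lemma connect_penultimate (D : {set T}) w v : w != v -> w \notin D ->
    connect (restrict h (~: D)) w v ->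
  exists b, [/\ h b v, b \notin v |: D & connect (restrict h (~: (v |: D))) w b].
Proof.
move=> wv wD /connectP[p]; elim: p w wv wD => [|c p IHp] w wv wD /=.
  by move=> _ E; rewrite E eqxx in wv.
case/andP=> /and3P[hwc _]; rewrite inE => cD pth lst.
have wvD : w \notin v |: D by rewrite !inE negb_or wv.
have [cv|cv] := eqVneq c v; first by exists w; rewrite -[in h w _]cv.
have [b [hbv bD cb]] := IHp c cv cD pth lst; exists b; split=> //.
apply: connect_trans cb; apply: connect1.
by rewrite /restrict /= hwc !in_setC wvD !inE negb_or cv.
Qed.

Hypothesis k0 : 0 < k.
Hypothesis kconn : kconnected k h.
Variables u v : T.
Hypothesis uv : u != v.

Let inner : rel T := restrict h (~: [set u; v]).
Let Nu : {set T} := [set a | h u a && (a != v)].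
Let Nv : {set T} := [set b | h v b && (b != u)].

(** The boolean [h u v] is subtracted because an edge [uv] will itself serve as one of the [k]
    paths. *)
Lemma separates_neighbours (S : {set T}) : separates inner Nu Nv S ->
  k - h u v <= #|S|.
Proof.
move=> sepS; rewrite leqNgt; apply/negP => ltS; have [kT kc] := kconn.
pose D := S :\: [set u; v].
have cD : #|D| <= #|S| by apply/subset_leq_card/subsetDl.
have uD : u \notin D by rewrite !inE eqxx.
have vD : v \notin D by rewrite !inE eqxx orbT.
suff [a [b [hau hbv aD bD cab]]] : exists a b, [/\ h a u, h b v,
    a \notin u |: (v |: D), b \notin u |: (v |: D) &
    connect (restrict h (~: (u |: (v |: D)))) a b].
  have DE z : z \notin u |: (v |: D) -> [/\ z != u, z != v & z \notin S].
    by rewrite /D !inE; case: (z == u); case: (z == v); case: (z \in S).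
  have [au av aS] := DE _ aD; have [bu bv bS] := DE _ bD.
  apply: (sepS a b).
  - by rewrite !inE aS symh hau av.
  - by rewrite !inE bS symh hbv bu.
  apply: connect_sub cab => x y /and3P[hxy]; rewrite !in_setC.
  move=> /DE[xu xv xS] /DE[yu yv yS]; apply: connect1.
  by rewrite /restrict /= /inner /restrict /= hxy !inE !negb_or xu xv xS yu yv yS.
have csym S' := sym_connect_sym (@restrict_sym S').
case huv: (h u v) ltS; last first.
  rewrite subn0 => ltS.
  have cuv := kc D (leq_ltn_trans cD ltS) _ _ uD vD.
  have [b [hbv bD cub]] := connect_penultimate uv uD cuv.
  have ub : b != u by apply: contraFneq huv => <-.
  rewrite csym in cub; have [a [hau aD cba]] := connect_penultimate ub bD cub.
  exists a, b; split => //; last by rewrite csym.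
  by rewrite in_setU1 negb_or ub.
move=> ltS.
(* For adjacent [u] and [v] a walk between them may be the edge alone. A third vertex [w] is
   therefore joined to [v] avoiding [u] and to [u] avoiding [v]; each time fewer than [k] vertices
   are deleted. *)
have [w wD] : exists w, w \notin u |: (v |: D).
  apply/existsP; rewrite -negb_forall; apply/negP => /forallP all.
  have : #|u |: (v |: D)| <= (#|D|).+2.
    by rewrite !cardsU1; lia.
  rewrite (_ : u |: (v |: D) = setT) ?cardsT; first by lia.
  by apply/setP => z; rewrite all in_setT.
have wE : w \notin v |: (u |: D) by rewrite setUCA.
move: wD; rewrite !in_setU1 !negb_or => /and3P[wu wv wD].
have ltD : #|D| < k.-1 by lia.
have [b [hbv bD cwb]] : exists b, [/\ h b v, b \notin v |: (u |: D) &
    connect (restrict h (~: (v |: (u |: D)))) w b].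
  apply: connect_penultimate => //; first by rewrite in_setU1 negb_or wu.
  apply: kc; first by rewrite cardsU1; lia.
    by rewrite in_setU1 negb_or wu.
  by rewrite in_setU1 negb_or eq_sym uv.
have [a [hau aD cwa]] : exists a, [/\ h a u, a \notin u |: (v |: D) &
    connect (restrict h (~: (u |: (v |: D)))) w a].
  apply: connect_penultimate => //; first by rewrite in_setU1 negb_or wv.
  apply: kc; first by rewrite cardsU1; lia.
    by rewrite in_setU1 negb_or wv.
  by rewrite in_setU1 negb_or uv.
exists a, b; split => //; first by rewrite setUCA.
by rewrite csym in cwa; rewrite setUCA in cwb; apply: connect_trans cwa cwb.
Qed.

(** Menger is applied between the neighbourhoods of [u] and [v] with both vertices removed; the
    paths are then prolonged to [u] and [v]. *)
Lemma kconnected_disjoint_paths : exists ps : seq (seq T),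
  [/\ size ps = k, uniq ps, (forall p, p \in ps -> is_path h u v p) &
      (forall i j, i < j < k ->
         ~~ has (fun x => x \in interior v (nth [::] ps j))
                (interior v (nth [::] ps i)))].
Proof.
have [P [PP PD]] := menger separates_neighbours.
pose full i := (P i).1 :: rcons (P i).2 v.
have inn i z : z \in (P i).1 :: (P i).2 -> (z != u) && (z != v).
  have [PA pth _ _] := PP i; rewrite inE => /orP[/eqP->|zp].
    move: PA; rewrite inE => /andP[hua ->]; rewrite andbT.
    by apply: contraTneq hua => ->; rewrite irrh.
  elim: (P i).2 (P i).1 pth zp => //= y s IHs x /andP[/and3P[_ _]].
  rewrite !inE negb_or => yuv pth /orP[/eqP->//|zs]; exact: IHs pth zs.
have intE i : interior v (full i) = (P i).1 :: (P i).2.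
  have <- : [seq x <- (P i).1 :: (P i).2 | x != v] = (P i).1 :: (P i).2.
    by apply/all_filterP/allP => z /inn/andP[].
  by rewrite /interior /full -rcons_cons filter_rcons eqxx.
have fullP i : is_path h u v (full i).
  have [PA pth PB PU] := PP i; rewrite /is_path /full.
  move: PA PB; rewrite !inE => /andP[hua _] /andP[hvb _].
  apply/and3P; split.
  - rewrite /= hua rcons_path symh hvb andbT.
    by apply: sub_path pth => x y /and3P[].
  - by rewrite /= last_rcons.
  have nuv z : z \in [set u; v] -> z \notin (P i).1 :: (P i).2.
    by move=> zuv; apply/negP => /inn; rewrite -negb_or; move: zuv; rewrite !inE => ->.
  rewrite cons_uniq -rcons_cons rcons_uniq mem_rcons inE negb_or uv PU.
  by rewrite !nuv // !inE eqxx ?orbT.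
have dis i j z : z \in interior v (full i) -> z \in interior v (full j) -> i = j.
  by rewrite !intE; apply: PD.
have injfull : injective full.
  by move=> i j E; apply: (dis i j (P i).1); rewrite -?E intE mem_head.
pose qs := [seq full i | i <- enum 'I_(k - h u v)].
have szq : size qs = k - h u v by rewrite size_map size_enum_ord.
have nthq i (lti : i < k - h u v) : nth [::] qs i = full (Ordinal lti).
  rewrite (nth_map (Ordinal lti)) ?size_enum_ord //; congr full.
  by apply: val_inj; rewrite /= nth_enum_ord.
have uq : uniq qs by rewrite map_inj_uniq // enum_uniq.
have qP p : p \in qs -> is_path h u v p by case/mapP => i _ ->.
have qD i j : i < j < k - h u v -> ~~ has (fun x => x \in interior v (nth [::] qs j))
                (interior v (nth [::] qs i)).
  case/andP=> ij jk; have ik := ltn_trans ij jk.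
  rewrite (nthq i ik) (nthq j jk); apply/hasPn => z zi; apply/negP => zj.
  by have := dis _ _ _ zi zj => /(congr1 val) /= E; rewrite E ltnn in ij.
case huv: (h u v) szq qD => szq qD; last by exists qs; rewrite subn0 in szq qD.
(* The edge [uv] supplies the missing path; its interior is empty. *)
exists ([:: v] :: qs); split.
- by rewrite /= szq; lia.
- rewrite /= uq andbT; apply/negP => /mapP[i _ E].
  by have := intE i; rewrite -E /interior /= eqxx.
- move=> p; rewrite inE => /orP[/eqP->|/qP //].
  by rewrite /is_path /= huv eqxx inE uv.
move=> [|i] [|j] //= ij; first by rewrite /interior /= eqxx.
by apply: qD; lia.
Qed.

End DisjointPaths.

(** * Counting edges of connected blocks *)

(** Grow a set from one vertex: by connectedness some edge leaves it, and each added vertex brings a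
    new edge. Orientation out of [X] counts each edge once. *)
Lemma connected_card_edges (T : finType) (r : rel T) (X V : {set T}) :
    (forall x y, r x y -> (x \in X) != (y \in X)) -> symmetric r ->
    (forall x y, x \in V -> y \in V -> connect r x y) ->
    (forall x y, r x y -> x \in V) ->
  #|V| <= #|[set z : T * T | (z.1 \in X) && r z.1 z.2]| + 1.
Proof.
move=> bip symr conn inV.
have [->|[x0 x0V]] := set_0Vmem V; first by rewrite cards0.
pose F (S : {set T}) :=
  [set z : T * T | [&& z.1 \in X, r z.1 z.2, z.1 \in S & z.2 \in S]].
suff H n : n < #|V| ->
    exists S : {set T}, [/\ x0 \in S, S \subset V, #|S| = n.+1 & n <= #|F S|].
  have V0 : 0 < #|V| by apply/card_gt0P; exists x0.
  have [|S [_ _ _ leF]] := H #|V|.-1; first by rewrite prednK.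
  rewrite -(prednK V0) addn1 ltnS (leq_trans leF) //; apply/subset_leq_card.
  by apply/subsetP=> z; rewrite !inE => /and4P[-> ->].
elim: n => [|n IHn] ltnV.
  by exists [set x0]; rewrite inE eqxx sub1set cards1.
have [S [x0S SV cS leF]] := IHn (ltnW ltnV).
have [x xS [y yS rxy]] : exists2 x, x \in S & exists2 y, y \notin S & r x y.
  have [/exists_inP[x xS /exists_inP[y yS rxy]]|] :=
    boolP [exists x in S, exists y in ~: S, r x y].
    by exists x => //; exists y => //; rewrite inE in yS.
  rewrite negb_exists_in => /forall_inP noex; exfalso.
  have out x y : x \in S -> r x y -> y \in S.
    move=> xS rxy; have := noex _ xS; rewrite negb_exists_in.
    by move=> /forall_inP/(_ y); rewrite inE rxy; case: (y \in S) => // /(_ isT).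
  have cl : closed r (mem S).
    move=> x y rxy; apply/idP/idP => /= H; first exact: out rxy.
    by apply: (out y x) => //; rewrite symr.
  have : V \subset S.
    apply/subsetP=> y yV; have := closed_connect cl (conn _ _ x0V yV).
    by move=> /= <-.
  by move=> /subset_leq_card; rewrite cS => /(leq_trans ltnV); rewrite ltnn.
have yV : y \in V by apply: (inV y x); rewrite symr.
exists (y |: S); split.
- by rewrite !inE x0S orbT.
- by apply/subsetP => z; rewrite !inE => /orP[/eqP->|/(subsetP SV)].
- by rewrite cardsU1 yS cS.
pose z := if x \in X then (x, y) else (y, x).
have zF : z \notin F S.
  by rewrite /z; case: ifP => _; rewrite inE /= (negbTE yS) !andbF.
apply: leq_trans (_ : #|z |: F S| <= _); first by rewrite cardsU1 zF.
apply/subset_leq_card/subsetP => w; rewrite inE => /orP[|]; last first.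
  by rewrite !inE => /and4P[-> -> -> ->]; rewrite !orbT.
rewrite inE => /eqP ->; rewrite /z; have := bip _ _ rxy.
case: (boolP (x \in X)) => xX; rewrite !inE /= ?eqxx ?xX ?xS ?rxy ?orbT //.
by rewrite symr rxy; case: (y \in X).
Qed.

(** With [c = n - m] and [d = t - m - 1] the slack is [c + d * (n - 1)]. It vanishes only if
    [c = 0], and [a - 1 <= c]. *)
Lemma weight_arith (n m t a : nat) : 0 < m -> m < t -> 0 < a ->
  m + a <= n + 1 ->
  n * m.-1 <= t.-1 * n.-1 /\ (t.-1 * n.-1 <= n * m.-1 -> a <= 1).
Proof.
case: m => // m _ mt a0 man.
have [d td] : exists d, t = m + 2 + d by exists (t - (m + 2)); lia.
have [c nc] : exists c, n = m + c + 1 by exists (n - (m + 1)); lia.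
have [b ab] : exists b, a = b + 1 by exists (a - 1); lia.
subst t n a; have bc : b <= c by lia.
have -> : (m + 2 + d).-1 = m + 1 + d by lia.
have -> : (m + c + 1).-1 = m + c by lia.
by split; nia.
Qed.

Lemma sum_tight (I : finType) (P : pred I) (F G : I -> nat) :
    (forall i, P i -> F i <= G i) ->
    \sum_(i | P i) G i <= \sum_(i | P i) F i -> forall i, P i -> F i = G i.
Proof.
move=> leFG leGF i Pi.
have := leqif_sum (fun j Pj => leqif_eq (leFG j Pj)).
by move=> /geq_leqif; rewrite leGF => /esym/forall_inP/(_ i Pi)/eqP.
Qed.

Section Blocks.
Variables (T I : finType) (e : rel T) (col : T -> T -> I) (k : nat).
Hypothesis syme : symmetric e.
Hypothesis symcol : forall x y, e x y -> col x y = col y x.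

Definition block_rel (i : I) : rel T := [rel x y | e x y && (col x y == i)].
Definition block_verts (i : I) : {set T} :=
  [set x | [exists y, block_rel i x y]].
Definition blocks : {set I} := [set col z.1 z.2 | z : T * T & e z.1 z.2].

Hypothesis conn : forall i x y, x \in block_verts i -> y \in block_verts i ->
  connect (block_rel i) x y.

(** If [X] is a class of a bipartition, each edge appears exactly once. *)
Definition oriented (X : {set T}) : {set T * T} :=
  [set z | (z.1 \in X) && e z.1 z.2].
Definition block_edges (X : {set T}) (i : I) : {set T * T} :=
  [set z in oriented X | col z.1 z.2 == i].
Definition spanning (X : {set T}) : {set I} :=
  [set i in blocks | X \subset block_verts i].

(* [f l] and [g l] are the second and the penultimate vertex of the l-th of k
   internally disjoint monochromatic paths from [u] to [v]. *)
Definition linked (u v : T) : Prop :=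
  exists f g : 'I_k -> T,
    [/\ forall l, e u (f l) /\ e v (g l),
        forall l, col u (f l) = col v (g l),
        injective f, injective g & forall l l', f l = g l' -> l = l'].

(** The possible second vertices of monochromatic paths from [u] to [v]. *)
Definition toward (u v : T) : {set T} :=
  [set y | e u y && (v \in block_verts (col u y))].

Lemma block_relC i : symmetric (block_rel i).
Proof.
move=> x y; rewrite /block_rel /= syme; case eyx: (e y x) => //=.
by rewrite (symcol eyx).
Qed.

Lemma mem_block_verts x y : e x y -> x \in block_verts (col x y).
Proof. by move=> exy; rewrite inE; apply/existsP; exists y; rewrite /block_rel /= exy eqxx. Qed.

Lemma mem_blocks x y : e x y -> col x y \in blocks.
Proof. by move=> exy; apply/imsetP; exists (x, y); rewrite ?inE. Qed.

Lemma toward_card u v : linked u v -> k <= #|toward u v|.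
Proof.
move=> [f [g [fg cfg injf _ _]]].
rewrite -[leqLHS]card_ord -(card_imset _ injf); apply/subset_leq_card.
apply/subsetP => _ /imsetP[l _ ->]; have [ef eg] := fg l.
by rewrite inE ef cfg mem_block_verts.
Qed.

(* All edges counted by [toward] being used, the path leaving [u] through [a]
   and the one entering [v] through [a] coincide. *)
Lemma tight_link_col u v a : linked u v ->
    #|toward u v| = k -> #|toward v u| = k ->
  a \in toward u v -> a \in toward v u -> col u a = col v a.
Proof.
move=> [f [g [fg cfg injf injg sep]]] cuv cvu.
have fE : f @: setT = toward u v.
  apply/eqP; rewrite eqEcard card_imset // cardsT card_ord cuv leqnn andbT.
  apply/subsetP => _ /imsetP[l _ ->]; have [ef eg] := fg l.
  by rewrite inE ef cfg mem_block_verts.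
have gE : g @: setT = toward v u.
  apply/eqP; rewrite eqEcard card_imset // cardsT card_ord cvu leqnn andbT.
  apply/subsetP => _ /imsetP[l _ ->]; have [ef eg] := fg l.
  by rewrite inE eg -cfg mem_block_verts.
rewrite -fE -gE => /imsetP[l _ al] /imsetP[l' _ al'].
have ll' : l = l' by apply: sep; rewrite -al.
by rewrite [in LHS]al [in RHS]al' cfg ll'.
Qed.

Lemma spanning_sum (X : {set T}) :
  #|spanning X| * #|X|.-1 <= \sum_(i in blocks) #|block_verts i :&: X|.-1.
Proof.
rewrite -sum_nat_const big_mkcond [leqRHS]big_mkcond /=; apply: leq_sum => i _.
rewrite inE; case: (i \in blocks) => //=.
by case: ifP => // /setIidPr ->.
Qed.

(** Fix [y0] in [Y]: every other vertex of [Y] shares a block with [y0], so the blocks through [y0]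
    cover [Y], and [y0] is discounted in each. *)
Lemma linked_class_sum (Y : {set T}) : 0 < k ->
    {in Y &, forall u v, u != v -> linked u v} ->
  #|Y|.-1 <= \sum_(i in blocks) #|block_verts i :&: Y|.-1.
Proof.
move=> k0 links; have [->|[y0 y0Y]] := set_0Vmem Y; first by rewrite cards0.
pose U i := if y0 \in block_verts i then (block_verts i :&: Y) :\ y0 else set0.
apply: leq_trans (_ : #|\bigcup_(i in blocks) U i| <= _).
  rewrite (cardsD1 y0 Y) y0Y /=; apply/subset_leq_card/subsetP => y.
  rewrite in_setD1 => /andP[yy0 yY].
  have [f [g [fg cfg _ _ _]]] : linked y0 y by apply: links; rewrite // eq_sym.
  have [ef eg] := fg (Ordinal k0).
  apply/bigcupP; exists (col y0 (f (Ordinal k0))); first exact: mem_blocks.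
  by rewrite /U mem_block_verts // in_setD1 yy0 in_setI yY cfg mem_block_verts.
elim/big_rec2: _ => [|i m B iB IH]; first by rewrite cards0.
apply: leq_trans (leq_card_setU _ _) (leq_add _ IH); rewrite /U.
case: ifP => [y0V|]; last by rewrite cards0.
by rewrite [in leqRHS](cardsD1 y0) in_setI y0V y0Y.
Qed.

(** * Inequalities obtained from one partition class *)

Section Class.
Variable X : {set T}.
Hypothesis bip : forall x y, e x y -> (x \in X) != (y \in X).
Hypothesis links : forall u v, u != v -> (u \in X) = (v \in X) -> linked u v.

Lemma sum_oriented (F : I -> nat) :
  \sum_(z in oriented X) F (col z.1 z.2) =
  \sum_(i in blocks) #|block_edges X i| * F i.
Proof.
rewrite (partition_big (fun z => col z.1 z.2) (mem blocks)) /=; last first.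
  by move=> z; rewrite inE => /andP[_ /mem_blocks].
apply: eq_bigr => i _.
rewrite (eq_bigr (fun=> F i)); last by move=> z /andP[_ /eqP->].
rewrite sum_nat_const; congr (_ * _).
by apply: eq_card => z; rewrite [LHS]unfold_in !inE.
Qed.

Lemma card_oriented : #|oriented X| = \sum_(i in blocks) #|block_edges X i|.
Proof.
rewrite -sum1_card (sum_oriented (fun=> 1)).
by apply: eq_bigr => i _; rewrite muln1.
Qed.

Lemma block_meets_class i : i \in blocks ->
  0 < #|block_verts i :&: X| /\ 0 < #|block_verts i :&: ~: X|.
Proof.
case/imsetP=> -[x y]; rewrite inE /= => exy ->.
have xV := mem_block_verts exy.
have yV : y \in block_verts (col x y).
  by rewrite symcol // mem_block_verts // syme.
have := bip exy; case xX: (x \in X); case yX: (y \in X) => // _; split;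
  apply/card_gt0P; [exists x|exists y|exists y|exists x];
  by rewrite !inE ?xX ?yX andbT; move: xV yV; rewrite !inE.
Qed.

Lemma block_connected i :
  #|block_verts i :&: X| + #|block_verts i :&: ~: X| <= #|block_edges X i| + 1.
Proof.
have := @connected_card_edges _ (block_rel i) X (block_verts i).
rewrite -[#|block_verts i|](cardsID X) setDE.
rewrite (_ : [set z : T * T | _] = block_edges X i); last first.
  by apply/setP => z; rewrite !inE /= andbA.
apply.
- by move=> x y /andP[/bip].
- exact: block_relC.
- exact: conn.
- by move=> x y /= xy; rewrite inE; apply/existsP; exists y.
Qed.

(** Both sides count triples of an edge, its end [v] in [X], and another vertex [w] of [X] in the
    block of that edge. *)
Lemma sum_toward :
  \sum_(i in blocks) #|block_edges X i| * #|block_verts i :&: X|.-1 =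
  \sum_(v in X) \sum_(w in X :\ v) #|toward v w|.
Proof.
rewrite -(sum_oriented (fun i => #|block_verts i :&: X|.-1)).
rewrite (eq_bigl (fun z : T * T => (z.1 \in X) && e z.1 z.2)); last first.
  by move=> z; rewrite inE.
rewrite -(pair_big_dep (mem X) e (fun v y => #|block_verts (col v y) :&: X|.-1)).
apply: eq_bigr => v vX; have {}vX : v \in X := vX.
under [RHS]eq_bigr => w _ do rewrite -sum1_card.
rewrite (exchange_big_dep (fun y => e v y)) /=; last first.
  by move=> w y _; rewrite inE => /andP[].
apply: eq_bigr => y evy; rewrite (cardsD1 v) inE mem_block_verts // vX /=.
rewrite -sum1_card; apply: eq_bigl => w; rewrite !inE evy /=.
by rewrite -andbA [in RHS](andbC (w \in X)).
Qed.

(** Non-spanning blocks fall under [weight_arith]; for a spanning block the extra unit turns the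
    inequality into an equality. *)
Lemma block_weight i : i \in blocks -> 1 < #|X| ->
  #|block_edges X i| * #|block_verts i :&: X|.-1 <=
    #|X|.-1 * (#|block_edges X i|.-1 + (i \in spanning X)).
Proof.
move=> iB X2; have cn := block_connected i.
have [m1 a1] := block_meets_class iB.
have [iS|iS] := boolP (i \in spanning X).
  by move: iS cn m1; rewrite inE => /andP[_ /setIidPr ->]; nia.
have mX : #|block_verts i :&: X| < #|X|.
  rewrite ltnNge; apply: contra iS => le; rewrite inE iB /=.
  by apply/setIidPr/eqP; rewrite eqEcard subsetIr.
by have [] := weight_arith m1 mX a1 cn; rewrite addn0.
Qed.

Lemma block_weight_tight i : i \in blocks -> i \notin spanning X ->
    #|X|.-1 * (#|block_edges X i|.-1 + (i \in spanning X)) <=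
    #|block_edges X i| * #|block_verts i :&: X|.-1 ->
  #|block_verts i :&: ~: X| <= 1.
Proof.
move=> iB iS; have cn := block_connected i.
have [m1 a1] := block_meets_class iB.
have mX : #|block_verts i :&: X| < #|X|.
  rewrite ltnNge; apply: contra iS => le; rewrite inE iB /=.
  by apply/setIidPr/eqP; rewrite eqEcard subsetIr.
by rewrite (negbTE iS) addn0; have [_] := weight_arith m1 mX a1 cn.
Qed.


(** Every block has an edge, so the truncated predecessors lose exactly one per block. *)
Lemma sum_excess :
  \sum_(i in blocks) (#|block_edges X i|.-1 + (i \in spanning X)) + #|blocks| =
  #|oriented X| + #|spanning X|.
Proof.
rewrite big_split /= card_oriented addnAC; congr (_ + _).
  rewrite -sum1_card -big_split /=; apply: eq_bigr => i iB.
  have cn := block_connected i; have [m1 a1] := block_meets_class iB.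
  have n0 : 0 < #|block_edges X i| by lia.
  by rewrite addn1 prednK.
rewrite -sum1_card big_mkcond [RHS]big_mkcond /=; apply: eq_bigr => i _.
by rewrite inE; case: (i \in blocks) => //=; case: (_ \subset _).
Qed.

Lemma sum_pairs_const :
  k * #|X| * #|X|.-1 = \sum_(v in X) \sum_(w in X :\ v) k.
Proof.
rewrite -mulnA mulnC -mulnA -sum_nat_const; apply: eq_bigr => v vX.
by rewrite sum_nat_const (cardsD1 v X) vX.
Qed.

(** Sum [toward_card] over ordered pairs in [X], regroup by blocks with [sum_toward], bound each
    block by [block_weight] and cancel [#|X|.-1]. *)
Lemma class_bound : 1 < #|X| ->
  k * #|X| + #|blocks| <= #|oriented X| + #|spanning X|.
Proof.
move=> X2; rewrite -sum_excess leq_add2r.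
have X1 : 0 < #|X|.-1 by lia.
rewrite -(leq_pmul2r X1) sum_pairs_const mulnC big_distrr /=.
apply: leq_trans (_ : \sum_(v in X) \sum_(w in X :\ v) #|toward v w| <= _).
  apply: leq_sum => v vX; apply: leq_sum => w; rewrite !inE => /andP[wv wX].
  by apply/toward_card/links; rewrite ?vX ?wX // eq_sym.
rewrite -sum_toward; apply: leq_sum => i iB; exact: block_weight.
Qed.

Lemma class_bound_two : 0 < k -> 1 < #|X| -> #|spanning X| = 2 ->
  k * #|X| + #|blocks| < #|oriented X| + 2.
Proof.
move=> k0 X2 S2; rewrite ltnNge; apply/negP.
rewrite -S2 -sum_excess leq_add2r => tight.
have X1 : 0 < #|X|.-1 by lia.
have wt := fun i iB => @block_weight i iB X2.
have tw v w : v \in X -> w \in X :\ v -> k <= #|toward v w|.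
  move=> vX; rewrite !inE => /andP[wv wX].
  by apply/toward_card/links; rewrite ?vX ?wX // eq_sym.
(* [le1], [le2] and [le3] form a closed chain, so every termwise inequality behind them is an
   equality. *)
have le1 : k * #|X| * #|X|.-1 <=
    \sum_(v in X) \sum_(w in X :\ v) #|toward v w|.
  rewrite sum_pairs_const; apply: leq_sum => v vX.
  by apply: leq_sum => w; apply: tw.
have le2 := @leq_sum _ (index_enum I) (mem blocks) _ _ wt; rewrite -big_distrr /= sum_toward in le2.
have le3 : #|X|.-1 *
    \sum_(i in blocks) (#|block_edges X i|.-1 + (i \in spanning X)) <=
    k * #|X| * #|X|.-1 by rewrite mulnC leq_mul2r tight orbT.
have blk i : i \in blocks -> i \notin spanning X ->
    #|block_verts i :&: ~: X| <= 1.
  move=> iB iS; apply: (block_weight_tight iB iS).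
  rewrite -(sum_tight wt _ iB) //.
  by rewrite -big_distrr /= sum_toward (leq_trans le3 le1).
have pairs v w : v \in X -> w \in X -> v != w -> #|toward v w| = k.
  move=> vX wX vw; apply/esym.
  have inner : forall v, v \in X ->
      \sum_(w in X :\ v) k <= \sum_(w in X :\ v) #|toward v w|.
    by move=> u uX; apply: leq_sum => z; apply: tw.
  apply: (sum_tight (tw v ^~ vX)); last by rewrite !inE eq_sym vw.
  by rewrite (sum_tight inner) // -sum_pairs_const (leq_trans le2).
have /cards2P[i1 [i2 [i12 SE]]] : #|spanning X| == 2 by rewrite S2.
have spanned i x : i \in [set i1; i2] -> x \in X -> x \in block_verts i.
  by rewrite -SE inE => /andP[_ /subsetP]; apply.
have i1S : i1 \in [set i1; i2] by rewrite !inE eqxx.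
have i2S : i2 \in [set i1; i2] by rewrite !inE eqxx orbT.
(* Such an [a] has neighbours [v] and [w] in [X] through [i1] and [i2]. Both blocks span [X], so [a]
   lies in [toward v w] and [toward w v], and tightness forces the two blocks to coincide. *)
have noboth a : a \notin X -> a \in block_verts i1 -> a \in block_verts i2 ->
    False.
  move=> aX; rewrite !inE => /existsP[v /andP[eav /eqP cav]].
  case/existsP => w /andP[eaw /eqP caw].
  have vX : v \in X by move: (bip eav); rewrite (negbTE aX); case: (v \in X).
  have wX : w \in X by move: (bip eaw); rewrite (negbTE aX); case: (w \in X).
  have vw : v != w.
    by apply: contra i12 => /eqP vw; rewrite -cav -caw vw.
  have cva : col v a = i1 by rewrite symcol // syme.
  have cwa : col w a = i2 by rewrite symcol // syme.
  have : col v a = col w a.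
    apply: tight_link_col.
    - by apply: links; rewrite // vX wX.
    - exact: pairs.
    - by apply: pairs => //; rewrite eq_sym.
    - by rewrite inE syme eav cva spanned.
    - by rewrite inE syme eaw cwa spanned.
  by rewrite cva cwa => E; move: i12; rewrite E eqxx.
have iB i : i \in [set i1; i2] -> i \in blocks by rewrite -SE inE => /andP[].
have ex i : i \in [set i1; i2] -> exists a, a \in block_verts i :&: ~: X.
  by move=> /iB/block_meets_class[_ /card_gt0P].
have [a1 /setIP[a1V]] := ex _ i1S; rewrite inE => a1X.
have [a2 /setIP[a2V]] := ex _ i2S; rewrite inE => a2X.
have [a12|a12] := eqVneq a1 a2.
  by apply: (noboth a2) => //; rewrite -a12.
(* [a1] and [a2] share a block: a spanning one contradicts [noboth], any other meets [~: X] only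
   once. *)
have [f [g [fg cfg _ _ _]]] : linked a1 a2.
  by apply: links; rewrite // (negbTE a1X) (negbTE a2X).
have [ef eg] := fg (Ordinal k0).
have a1i : a1 \in block_verts (col a1 (f (Ordinal k0))) by exact: mem_block_verts.
have a2i : a2 \in block_verts (col a1 (f (Ordinal k0))).
  by rewrite cfg mem_block_verts.
have [iS|iS] := boolP (col a1 (f (Ordinal k0)) \in spanning X).
  move: iS; rewrite SE !inE => /orP[] /eqP E.
    by apply: (noboth a2) => //; rewrite -E.
  by apply: (noboth a1) => //; rewrite -E.
have := blk _ (mem_blocks ef) iS; rewrite leqNgt => /negP; apply.
apply/card_gt1P; exists a1, a2; split => //; by rewrite in_setI in_setC ?a1X ?a2X ?a1i ?a2i.
Qed.

Lemma card_orientedC : #|oriented (~: X)| = #|oriented X|.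
Proof.
pose sw (z : T * T) := (z.2, z.1).
have swK : involutive sw by case.
rewrite -(card_imset _ (inv_inj swK)); apply: eq_card => z.
rewrite (can2_imset_pre _ swK swK) !inE /= syme.
case ez: (e z.1 z.2); rewrite ?andbF //= ?andbT.
by have := bip ez; case: (z.1 \in X); case: (z.2 \in X).
Qed.

(** This sums [block_connected], both traces of a block being nonempty. *)
Lemma block_count_le :
  \sum_(i in blocks) #|block_verts i :&: X|.-1 +
  \sum_(i in blocks) #|block_verts i :&: ~: X|.-1 + #|blocks| <= #|oriented X|.
Proof.
rewrite card_oriented -sum1_card -!big_split /=; apply: leq_sum => i iB.
have cn := block_connected i; have [m1 a1] := block_meets_class iB.
by move: cn m1 a1; case: #|_| => // m; case: #|_| => // a; rewrite /=; lia.
Qed.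

End Class.

Lemma block_bound (A : {set T}) :
    (forall x y, e x y -> (x \in A) != (y \in A)) ->
    (forall u v, u != v -> (u \in A) = (v \in A) -> linked u v) ->
    2 <= k -> k <= #|A| -> #|A| <= #|~: A| ->
    (k <= 3 \/ (#|A| = #|~: A| /\ k <= 5)) ->
  k * #|~: A| + #|blocks| <= #|oriented A| + 1.
Proof.
move=> bip links k2 ks st cond.
have bipC x y : e x y -> (x \in ~: A) != (y \in ~: A).
  by rewrite !inE => /bip; case: (x \in A); case: (y \in A).
have linksC u v : u != v -> (u \in ~: A) = (v \in ~: A) -> linked u v.
  by move=> uv; rewrite !inE => /negb_inj; apply: links.
have k0 : 0 < k by lia.
have oC := card_orientedC bip.
have t2 : 1 < #|~: A| by lia.
have s2 : 1 < #|A| by lia.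
have cntC := block_count_le bip.
have spA := spanning_sum A; have spB := spanning_sum (~: A).
have lsA : #|A|.-1 <= \sum_(i in blocks) #|block_verts i :&: A|.-1.
  by apply: linked_class_sum => // u v uA vA uv; apply: links; rewrite // uA vA.
have cb := class_bound bipC linksC t2; have cb2 := class_bound_two bipC linksC k0 t2.
have cbA := class_bound bip links s2; have cb2A := class_bound_two bip links k0 s2.
rewrite oC in cb cb2; clear -k2 ks st cond cntC spA spB lsA cb cb2 cbA cb2A.
move: cb cb2 cbA cb2A spA spB lsA cntC ks st cond.
move: #|spanning _| #|spanning _| #|A| #|~: A| #|oriented A| #|blocks|.
move: (\sum_(i in _) _) (\sum_(i in _) _).
(* Only arithmetic remains: [p] and [q] count the blocks spanning [~: A] and [A], [E] the edges and
   [b] all blocks. *)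
move=> WB WA q p s t E b cb cb2 cbA cb2A spA spB lsA cnt ks st cond.
have [p1|p1] := leqP p 1; first by lia.
have [p2|p2] := eqVneq p 2; first by have := cb2 p2; lia.
have [pk|pk] := leqP k p; first by nia.
case: cond => [|[eqst k5]]; first by lia.
subst t.
have [q1|q1] := leqP q 1; first by lia.
have [q2|q2] := eqVneq q 2; first by have := cb2A q2; lia.
(* Here [p] and [q] are at least 3, and [6 * (s - 1) >= k * s - 1] because [k <= 5] and [k <= s]; it
   is sharp for [k = s = 5]. *)
have : (p + q) * s.-1 + b <= E by nia.
by nia.
Qed.

End Blocks.

(** * Blocks of a colouring *)

(** The class [A] determines the orientation, so forgetting it is injective. *)
Lemma card_oriented_edges (T : finType) (e : rel T) (A : {set T}) :
    symmetric e -> (forall x y, e x y -> (x \in A) != (y \in A)) ->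
  #|oriented e A| = nedges e.
Proof.
move=> syme bip; pose m (z : T * T) := [set z.1; z.2].
rewrite /nedges -(card_in_imset (f := m)).
  apply: eq_card => E; apply/imsetP/imset2P => [[[x y]]|[x y _]].
    by rewrite inE /= => /andP[_ exy] ->; exists x y; rewrite ?inE.
  rewrite inE /= => exy ->; have := bip _ _ exy.
  have [xA _|xA yA] := boolP (x \in A); first by exists (x, y); rewrite // inE /= xA.
  exists (y, x); last by rewrite /m /= setUC.
  by rewrite inE /= syme exy andbT; case: (y \in A) yA.
move=> [x y] [x' y']; rewrite !inE /= => /andP[xA exy] /andP[xA' exy'] /setP mE.
have := bip _ _ exy; have := bip _ _ exy'; rewrite xA xA' => yA' yA.
have xx' : x = x'.
  have := mE x; rewrite !inE eqxx /= => /esym/orP[/eqP //|/eqP xy'].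
  by rewrite -xy' xA in yA'.
have yy' : y = y'.
  have := mE y; rewrite !inE eqxx orbT => /esym/orP[/eqP yx'|/eqP //].
  by rewrite yx' xA' in yA.
by rewrite xx' yy'.
Qed.

Lemma size_undup_map (S S' : eqType) (f : S -> S') (s : seq S) :
  size (undup (map f s)) <= size (undup s).
Proof.
rewrite -(size_map f (undup s)); apply: uniq_leq_size (undup_uniq _) _ => y.
rewrite mem_undup => /mapP[x xs ->].
by apply: map_f; rewrite mem_undup.
Qed.

Section Colouring.
Variables (T : finType) (e : rel T) (c : {set T} -> nat).
Hypothesis syme : symmetric e.

Definition mono_rel (i : nat) : rel T :=
  [rel x y | e x y && (c [set x; y] == i)].

(* The connected component of the edge xy in its colour class, as a set of
   oriented edges. *)
Definition colour_block (x y : T) : {set T * T} :=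
  [set z | [&& e z.1 z.2, c [set z.1; z.2] == c [set x; y] &
               connect (mono_rel (c [set x; y])) x z.1]].

Lemma mono_relC i : symmetric (mono_rel i).
Proof. by move=> x y; rewrite /mono_rel /= syme setUC. Qed.

Lemma colour_block_eq x y u v : c [set x; y] = c [set u; v] ->
  connect (mono_rel (c [set x; y])) x u -> colour_block x y = colour_block u v.
Proof.
move=> cE xu; apply/setP => z; rewrite !inE -cE.
by rewrite (same_connect (sym_connect_sym (@mono_relC _)) xu).
Qed.

(** The pair [(u, v)] lies in its own block, hence in that of [x] and [y]. *)
Lemma colour_block_inv x y u v : e u v -> colour_block x y = colour_block u v ->
  c [set x; y] = c [set u; v] /\ connect (mono_rel (c [set x; y])) x u.
Proof.
move=> euv /setP/(_ (u, v)); rewrite !inE /= euv eqxx connect0 /=.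
by case/andP => /eqP.
Qed.

Lemma colour_blockC x y : e x y -> colour_block x y = colour_block y x.
Proof.
move=> exy; apply: colour_block_eq; first by rewrite setUC.
by apply: connect1; rewrite /mono_rel /= exy eqxx.
Qed.

(** All edges of a monochromatic walk starting at [x] in the colour of [i] belong to the block
    [i]. *)
Lemma colour_block_connected i x y :
    x \in block_verts e colour_block i -> y \in block_verts e colour_block i ->
  connect (block_rel e colour_block i) x y.
Proof.
rewrite !inE => /existsP[x' /andP[exx' /eqP xi]] /existsP[y' /andP[eyy' /eqP yi]].
have [cE] : c [set x; x'] = c [set y; y'] /\
    connect (mono_rel (c [set x; x'])) x y.
  by apply: colour_block_inv; rewrite // xi.
case/connectP=> p pth ->.
suff H u : path (mono_rel (c [set x; x'])) u p ->
    connect (mono_rel (c [set x; x'])) x u ->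
    connect (block_rel e colour_block i) u (last u p).
  by apply: H pth (connect0 _ _).
elim: p u {pth} => [|w p IHp] u /=; first by rewrite connect0.
case/andP=> uw pth xu; have /andP[euw /eqP cuw] := uw.
apply: connect_trans (IHp _ pth (connect_trans xu (connect1 uw))).
apply: connect1; rewrite /block_rel /= euw -xi eq_sym.
by apply/eqP/colour_block_eq.
Qed.

Lemma ncolours_le_blocks : ncolours e c <= #|blocks e colour_block|.
Proof.
(* Any edge of a block reveals its colour, so blocks map onto colours; the default [0] is only for
   the empty set, which is not a block. *)
pose phi (b : {set T * T}) := if [pick z in b] is Some z then c [set z.1; z.2] else 0.
pose F (z : T * T) := colour_block z.1 z.2.
pose s := [seq F z | z <- enum [set z : T * T | e z.1 z.2]].
have -> : #|blocks e colour_block| = size (undup s).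
  rewrite -(card_uniqP (undup_uniq s)); apply: eq_card => b.
  rewrite mem_undup; apply/imsetP/mapP => -[z zE ->].
    by exists z; rewrite // mem_enum.
  by exists z; rewrite // -mem_enum.
apply: leq_trans (size_undup_map phi s).
apply: uniq_leq_size (undup_uniq _) _ => i.
rewrite !mem_undup => /mapP[E]; rewrite mem_enum => /imset2P[x y _].
rewrite inE => /= exy -> ->; apply/mapP; exists (F (x, y)).
  by apply: map_f; rewrite mem_enum inE.
rewrite /phi; case: pickP => [z|/(_ (x, y))].
  by rewrite inE => /and3P[_ /eqP-> _].
by rewrite /= inE /= exy eqxx connect0.
Qed.

Lemma mono_path_rel u p i : path e u p ->
    all (fun xy => c [set xy.1; xy.2] == i) (zip (u :: p) p) ->
  path (mono_rel i) u p.
Proof.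
elim: p u => //= w p IHp u /andP[euw pth] /andP[cuw cp].
by rewrite /mono_rel /= euw cuw; apply: IHp.
Qed.

(** The second and the penultimate vertex of each path are interior, so disjointness separates them
    between paths; being monochromatic, a path has its first and last edge in one block. *)
Lemma colouring_linked k (A : {set T}) u v :
    (forall x y, e x y -> (x \in A) != (y \in A)) ->
    mono_kconn_colouring k e c -> u != v -> (u \in A) = (v \in A) ->
  linked e colour_block k u v.
Proof.
move=> bip mono uv uvA; have [ps [sz _ psP disj]] := mono u v uv.
pose p (l : 'I_k) := nth [::] ps l.
have key l : exists yz : T * T,
    [/\ e u yz.1, e v yz.2, colour_block u yz.1 = colour_block v yz.2,
        yz.1 \in interior v (p l) & yz.2 \in interior v (p l)].
  have /psP[/and3P[pth /eqP lst unq] [i ci]] : p l \in ps.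
    by apply: mem_nth; rewrite sz.
  have := mono_path_rel pth ci; rewrite /interior.
  move: (p l) pth lst unq {ci}; case/lastP => [|q w].
    by move=> _ /= E; rewrite E eqxx in uv.
  rewrite last_rcons => pth wv; subst w; move: pth.
  (* A path without interior would be an edge inside one class. *)
  case: q => [|y q].
    by move=> /= /andP[/bip/negP[]]; rewrite uvA.
  move=> pth unq mth.
  have := pth; rewrite rcons_path => /andP[/= /andP[euy _] elv].
  have vq : v \notin y :: q.
    by move: unq; rewrite cons_uniq rcons_uniq => /and3P[_ -> _].
  have := mth; rewrite rcons_path => /andP[/= /andP[muy mq] mlv].
  have [/andP[_ cuy] /andP[_ clv]] := (muy, mlv).
  have inN z : z \in y :: q -> z \in [seq x <- rcons (y :: q) v | x != v].
    move=> zq; rewrite mem_filter mem_rcons inE zq orbT andbT.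
    by apply: contraNneq vq => <-.
  have cE : c [set u; y] = c [set v; last y q].
    by rewrite (eqP cuy) [in RHS]setUC (eqP clv).
  exists (y, last y q); split; rewrite ?[fst _]/= ?[snd _]/=.
  - exact: euy.
  - by rewrite syme.
  - apply: colour_block_eq => //; rewrite (eqP cuy).
    by apply/connectP; exists (rcons (y :: q) v); rewrite ?last_rcons.
  - by rewrite inN ?mem_head.
  - by rewrite inN ?mem_last.
have [fg fgP] := @fin_all_exists _ _ (fun l yz => _) key.
have disj' (l l' : 'I_k) z : z \in interior v (p l) -> z \in interior v (p l') ->
    l = l'.
  move=> zl zl'; apply/val_inj/eqP; rewrite eqn_leq; apply/andP; split.
    rewrite leqNgt; apply/negP => lt.
    have := disj l' l; rewrite lt ltn_ord => /(_ isT)/negP[].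
    by apply/hasP; exists z.
  rewrite leqNgt; apply/negP => lt.
  have := disj l l'; rewrite lt ltn_ord => /(_ isT)/negP[].
  by apply/hasP; exists z.
exists (fun l => (fg l).1), (fun l => (fg l).2); split.
- by move=> l; case: (fgP l).
- by move=> l; case: (fgP l).
- move=> l l' E; have [_ _ _ fl _] := fgP l; have [_ _ _ fl' _] := fgP l'.
  by apply: disj' fl _; rewrite E.
- move=> l l' E; have [_ _ _ _ gl] := fgP l; have [_ _ _ _ gl'] := fgP l'.
  by apply: disj' gl _; rewrite E.
- move=> l l' E; have [_ _ _ fl _] := fgP l; have [_ _ _ _ gl'] := fgP l'.
  by apply: disj' fl _; rewrite E.
Qed.

End Colouring.

(** The additive form avoids truncated subtraction. *)
Lemma ncolours_upper (T : finType) (e : rel T) (k s t : nat) c :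
    symmetric e -> 2 <= k -> k <= s -> s <= t ->
    (k <= 3 \/ (s = t /\ k <= 5)) -> bipartite_classes e s t ->
    mono_kconn_colouring k e c ->
  k * t + ncolours e c <= nedges e + 1.
Proof.
move=> syme k2 ks st cond [A [sA tA bip]] mono; subst s t.
rewrite -(card_oriented_edges syme bip).
apply: leq_trans (_ : _ <= k * #|~: A| + #|blocks e (colour_block e c)|) _.
  by rewrite leq_add2l ncolours_le_blocks.
apply: block_bound => //.
- exact: colour_blockC.
- exact: colour_block_connected.
- by move=> u v; apply: colouring_linked.
Qed.

(** * The extremal colouring *)

Lemma ncolours_one_class (T : finType) (e h : rel T) : subrel h e ->
    edges h != set0 ->
  exists c : {set T} -> nat, (forall x y, h x y -> c [set x; y] = 0) /\
    ncolours e c = nedges e - nedges h + 1.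
Proof.
move=> sub h0; have subE : edges h \subset edges e.
  apply/subsetP => _ /imset2P[x y _ xy ->]; apply/imset2P; exists x y => //.
  by move: xy; rewrite !inE /= => /sub.
(* The successor keeps the private colours apart from the common colour [0]. *)
pose c (E : {set T}) := if E \in edges h then 0 else (enum_rank E).+1.
exists c; split.
  move=> x y hxy; rewrite /c ifT //; apply/imset2P; exists x y; by rewrite ?inE.
rewrite /ncolours /nedges -(cardsDS subE) addn1.
set s := [seq c E | E <- enum (edges e :\: edges h)].
have -> : #|edges e :\: edges h| = size s by rewrite size_map cardE.
rewrite -[RHS]/(size (0 :: s)); apply/perm_size/uniq_perm.
- exact: undup_uniq.
- rewrite /= map_inj_in_uniq ?enum_uniq ?andbT.
    apply/negP => /mapP[E]; rewrite mem_enum inE /c => /andP[/negbTE-> _] //.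
  move=> E F; rewrite !mem_enum !inE /c => /andP[/negbTE-> _] /andP[/negbTE-> _].
  by case=> /val_inj/enum_rank_inj.
move=> i; rewrite mem_undup inE; apply/mapP/orP => [[E]|[/eqP->|/mapP[E]]].
- rewrite mem_enum => Ee ->; have [Eh|Eh] := boolP (E \in edges h).
    by left; rewrite /c Eh.
  by right; apply: map_f; rewrite mem_enum inE Eh.
- case/set0Pn: h0 => E Eh; exists E; last by rewrite /c Eh.
  by rewrite mem_enum (subsetP subE).
- by rewrite mem_enum inE => /andP[_ Ee] ->; exists E; rewrite ?mem_enum.
Qed.

Lemma mono_kconn_of_subgraph (T : finType) (e h : rel T) k c : 0 < k ->
    symmetric h -> irreflexive h -> subrel h e -> kconnected k h ->
    (forall x y, h x y -> c [set x; y] = 0) ->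
  mono_kconn_colouring k e c.
Proof.
move=> k0 symh irrh sub kc c0 u v uv.
have [ps [sz unq psP dis]] := kconnected_disjoint_paths symh irrh k0 kc uv.
exists ps; split=> // p /psP/and3P[pth lst pu]; split.
  by rewrite /is_path lst pu !andbT; apply: sub_path pth.
exists 0; elim: p u {uv psP dis lst pu} pth => //= y p IHp u /andP[huy pth].
by rewrite c0 // eqxx IHp.
Qed.

Theorem theorem3p4 (T : finType) (e : rel T) (k s t : nat) (h : rel T) :
  simple_graph e ->
  2 <= k -> k <= s -> s <= t ->
  (k <= 3 \/ (s = t /\ k <= 5)) ->
  bipartite_classes e s t ->
  kconnected k e ->
  min_spanning_kconn k e h ->
  nedges h = k * t ->
  mc_eq k e (nedges e - k * t + 1).
Proof.
move=> [syme irre] k2 ks st cond bip _ [[symh sub] [kh _]] eh.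
have k0 : 0 < k by lia.
have irrh : irreflexive h.
  by move=> x; apply/negP => /sub; rewrite irre.
(* Colour [0] has to occur in order to contribute the final [+ 1]. *)
have h0 : edges h != set0.
  by rewrite -card_gt0 -[#|_|]/(nedges h) eh; nia.
have [c [c0 cE]] := ncolours_one_class sub h0.
split; last first.
  move=> c' mono; have := ncolours_upper syme k2 ks st cond bip mono; lia.
exists c; split; last by rewrite cE eh.
exact: mono_kconn_of_subgraph c0.
Qed.
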